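(* Let $a=a(t)$ be a (sufficiently smooth, or analytic) function and consider the pair of linear systems $$Z_\lambda=\mathcal A Z,\qquad Z_t=\mathcal C Z$$ with coefficient matrices $$\mathcal A=-\tfrac3{20}a''\sigma_3+\bigl(\tfrac1{30}\lambda^4+\alpha_3\lambda^3+\alpha_2\lambda^2+\alpha_1\lambda+\alpha_0\bigr)\sigma_++\bigl(\tfrac1{30}\lambda-\alpha_3\bigr)\sigma_-,$$ $$\alpha_3=-\tfrac1{10}a',\quad \alpha_2=\tfrac3{10}(a')^2-t,\quad \alpha_1=-\tfrac9{10}(a')^3+3a't+a,$$ $$\alpha_0=3aa'-\tfrac{27}4(a')^4+\tfrac95t(a')^2+\tfrac{27}{20}c_6+\tfrac{81}5t^2,$$ $$\mathcal C=\bigl[-\tfrac13\lambda^3+\beta_2\lambda^2+\beta_1\lambda+\beta_0\bigr]\sigma_+-\tfrac13\sigma_-,$$ $$\beta_2=2a',\quad \beta_1=10t-9(a')^2,\quad \beta_0=36(a')^3-60a't-10a,$$ where $c_6=-\tfrac13a'''-3(a')^4+12(a')^2t-12t^2$. Then the equation $$a''''+120(a')^3a''-120a'a''t-\tfrac{200}3(a')^2-\tfrac{40}3aa''+\tfrac{200}9t=0$$ controls the isomonodromy deformations of the linear matrix equation $Z_\lambda=\mathcal AZ$ described by this pair; that is, the compatibility condition $\mathcal A_t-\mathcal C_\lambda+[\mathcal A,\mathcal C]=0$ (identically in $\lambda$) holds if and only if $a(t)$ satisfies this equation.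
   Context: Primes denote $d/dt$; subscripts $\lambda,t$ denote partial derivatives. $\sigma_3=\begin{pmatrix}1&0\\0&-1\end{pmatrix}$, $\sigma_+=\begin{pmatrix}0&1\\0&0\end{pmatrix}$, $\sigma_-=\begin{pmatrix}0&0\\1&0\end{pmatrix}$. *)

(* Defs.v *)
From HB Require Import structures.
From mathcomp Require Import all_boot all_order ssralg ssrnum zmodp matrix.
From mathcomp Require Import boolp classical_sets functions.
From mathcomp Require Import topology normedtype derive.

Set Implicit Arguments.
Unset Strict Implicit.
Unset Printing Implicit Defensive.

Import Order.TTheory GRing.Theory Num.Theory.
Import numFieldNormedType.Exports.

Local Open Scope ring_scope.
Local Open Scope classical_set_scope.

(* The scalar field is an arbitrary [numFieldType] with the topology of its
   norm.  Over a [realType] the derivatives below are real derivatives; over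
   its complexification they are complex ones, so that a function
   differentiable on an open set is then analytic. *)

Section Pauli.
Variable K : numFieldType.

Definition sigma3 : 'M[K]_2 := delta_mx 0 0 - delta_mx 1 1.
Definition sigma_plus : 'M[K]_2 := delta_mx 0 1.
Definition sigma_minus : 'M[K]_2 := delta_mx 1 0.

End Pauli.

Arguments sigma3 {K}.
Arguments sigma_plus {K}.
Arguments sigma_minus {K}.

Section Compatibility.
Variable K : numFieldType.

Definition commutator (X Y : 'M[K]_2) : 'M[K]_2 := X *m Y - Y *m X.

(* The compatibility condition, identically in [l], of
   Z_l = A l t Z and Z_t = C l t Z. *)
Definition compatible_at (A C : K -> K -> 'M[K]_2) (t : K) : Prop :=
  forall l : K,
    (fun s => A l s)^`() t - (fun m => C m t)^`() l
      + commutator (A l t) (C l t) = 0.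

End Compatibility.

Section LaxPair.
Variables (K : numFieldType) (a : K -> K).

Definition c6 (t : K) : K :=
  - (1 / 3) * a^`(3) t - 3 * (a^`() t) ^+ 4 + 12 * (a^`() t) ^+ 2 * t
  - 12 * t ^+ 2.

Definition alpha3 (t : K) : K := - (1 / 10) * a^`() t.

Definition alpha2 (t : K) : K := 3 / 10 * (a^`() t) ^+ 2 - t.

Definition alpha1 (t : K) : K :=
  - (9 / 10) * (a^`() t) ^+ 3 + 3 * a^`() t * t + a t.

Definition alpha0 (t : K) : K :=
  3 * a t * a^`() t - 27 / 4 * (a^`() t) ^+ 4
  + 9 / 5 * t * (a^`() t) ^+ 2 + 27 / 20 * c6 t + 81 / 5 * t ^+ 2.

Definition beta2 (t : K) : K := 2 * a^`() t.

Definition beta1 (t : K) : K := 10 * t - 9 * (a^`() t) ^+ 2.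

Definition beta0 (t : K) : K :=
  36 * (a^`() t) ^+ 3 - 60 * a^`() t * t - 10 * a t.

Definition matA (l t : K) : 'M[K]_2 :=
  (- (3 / 20) * a^`(2) t) *: sigma3
  + (1 / 30 * l ^+ 4 + alpha3 t * l ^+ 3 + alpha2 t * l ^+ 2
     + alpha1 t * l + alpha0 t) *: sigma_plus
  + (1 / 30 * l - alpha3 t) *: sigma_minus.

Definition matC (l t : K) : 'M[K]_2 :=
  (- (1 / 3) * l ^+ 3 + beta2 t * l ^+ 2 + beta1 t * l + beta0 t)
    *: sigma_plus
  - (1 / 3) *: sigma_minus.

Definition isomonodromy_ode_at (t : K) : Prop :=
  a^`(4) t + 120 * (a^`() t) ^+ 3 * a^`(2) t
  - 120 * a^`() t * a^`(2) t * t
  - 200 / 3 * (a^`() t) ^+ 2 - 40 / 3 * a t * a^`(2) t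
  + 200 / 9 * t = 0.

End LaxPair.

(* Main.v *)
Require Import Defs.
From mathcomp Require Import all_boot all_order ssralg ssrnum zmodp matrix.
From mathcomp Require Import boolp classical_sets functions.
From mathcomp Require Import topology normedtype derive.
From mathcomp Require Import ring.

Import Order.TTheory GRing.Theory Num.Theory.
Import numFieldNormedType.Exports.

Local Open Scope ring_scope.
Local Open Scope classical_set_scope.

(* The matrix [A_t - C_l + [A, C]] is a polynomial in [l].  Substituting the
   coefficients, the [sigma3] and [sigma_minus] components vanish identically,
   and so do all coefficients of the [sigma_plus] component except the constant
   one, which equals -9/20 times the left-hand side of the ODE. *)

(** The difference quotient factors as a scalar quotient times [w], and scaling a fixed vector is
    continuous. This reduces differentiating the matrices to differentiating their coefficients. *)
Lemma is_deriveZl {K : numFieldType} {V W : normedModType K} (f : V -> K)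
    (w : W) (x v : V) (df : K) :
  is_derive x v f df -> is_derive x v (fun z => f z *: w) (df *: w).
Proof.
move=> f_df.
suff cvg_quot : (fun h : K => h^-1 *: (((fun z => f z *: w) \o shift x) (h *: v)
    - f x *: w)) @ 0^' --> df *: w.
  by apply: DeriveDef; [apply/cvg_ex; exists (df *: w) | exact: cvg_lim].
rewrite [X in X @ _](_ : _ =
    fun h : K => (h^-1 *: ((f \o shift x) (h *: v) - f x)) *: w).
  by apply: cvgZr_tmp; rewrite -(@derive_val _ _ _ _ _ _ _ f_df); exact: ex_derive.
by apply/funext => h /=; rewrite -scalerBl scalerA.
Qed.

(** * Differentiation of scalar polynomial expressions *)

Section ScalarDerivatives.
Context {K : numFieldType}.
Implicit Types (f g : K -> K) (x df dg : K).

Lemma is_derive_id1 x : is_derive x 1 (fun z : K => z) 1.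
Proof. exact: is_derive_id. Qed.

Lemma is_derive_add_fun {f g x df dg} :
  is_derive x 1 f df -> is_derive x 1 g dg ->
  is_derive x 1 (fun z => f z + g z) (df + dg).
Proof. exact: is_deriveD. Qed.

Lemma is_derive_opp_fun {f x df} :
  is_derive x 1 f df -> is_derive x 1 (fun z => - f z) (- df).
Proof. exact: is_deriveN. Qed.

Lemma is_derive_mul_fun {f g x df dg} :
  is_derive x 1 f df -> is_derive x 1 g dg ->
  is_derive x 1 (fun z => f z * g z) (f x * dg + g x * df).
Proof. exact: is_deriveM. Qed.

(** The exponent has the form [n.+1] so that no predecessor appears in the derivative. *)
Lemma is_derive_exp_fun {f x df} (n : nat) :
  is_derive x 1 f df ->
  is_derive x 1 (fun z => f z ^+ n.+1) (n.+1%:R * f x ^+ n * df).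
Proof. by move=> f_df; have := is_deriveX n.+1 f_df; rewrite exprfctE. Qed.

End ScalarDerivatives.

(* Syntax-directed, because class inference on the pointwise operations of
   functions is far too slow on the polynomials below. *)
Ltac solve_is_derive :=
  lazymatch goal with
  | |- is_derive _ _ (fun=> ?c) _ => exact: is_derive_cst
  | |- is_derive _ _ (fun z => @GRing.add _ (@?f z) (@?g z)) _ =>
      notypeclasses refine (@is_derive_add_fun _ f g _ _ _ _ _); solve_is_derive
  | |- is_derive _ _ (fun z => @GRing.opp _ (@?f z)) _ =>
      notypeclasses refine (@is_derive_opp_fun _ f _ _ _); solve_is_derive
  | |- is_derive _ _ (fun z => @GRing.mul _ (@?f z) (@?g z)) _ =>
      notypeclasses refine (@is_derive_mul_fun _ f g _ _ _ _ _); solve_is_derive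
  | |- is_derive _ _ (fun z => @GRing.exp _ (@?f z) _) _ =>
      notypeclasses refine (@is_derive_exp_fun _ f _ _ _ _); solve_is_derive
  | |- _ => eassumption
  end.

(** The derivative is first computed as an unknown; what remains is its equality with the stated
    value. *)
Ltac prove_is_derive :=
  notypeclasses refine (@is_derive_eq _ _ _ _ _ _ _ _ _ _);
  [solve_is_derive | cbv beta].

Lemma derive1_val {K : numFieldType} {V : normedModType K} (f : K -> V)
    (x : K) (df : V) : is_derive x 1 f df -> f^`() x = df.
Proof. by move=> f_df; rewrite derive1E derive_val. Qed.

(** * Derivatives of the pair and its curvature *)

Section LaxPairDerivatives.
Context {K : numFieldType}.

Lemma derive1_matC (a : K -> K) (l t : K) :
  (fun m => matC a m t)^`() l
  = (- l ^+ 2 + 2 * beta2 a t * l + beta1 a t) *: sigma_plus.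
Proof.
apply: derive1_val; rewrite /matC.
have dl := is_derive_id1 l.
pose r (m : K) :=
  - (1 / 3) * m ^+ 3 + beta2 a t * m ^+ 2 + beta1 a t * m + beta0 a t.
have dr : is_derive l 1 r (- l ^+ 2 + 2 * beta2 a t * l + beta1 a t).
  rewrite /r; prove_is_derive.
  by field.
(* The subtracted 0 is the derivative of the constant [sigma_minus] term. *)
rewrite -[X in is_derive _ _ _ X]subr0.
apply: (@is_deriveB _ _ _ (fun m => r m *: sigma_plus)
  (fun=> (1 / 3) *: sigma_minus)).
exact: is_deriveZl.
Qed.

Variables (a : K -> K) (t : K).
Hypothesis a_derivable :
  forall n : nat, (n < 4)%N -> derivable (derive1n n a) t 1.

Lemma is_derive_derive1n (n : nat) :
  (n < 4)%N -> is_derive t 1 (a^`(n)) (a^`(n.+1) t).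
Proof.
by move=> n_lt4; rewrite derive1nS derive1E; exact/derivableP/a_derivable.
Qed.

(** The jet of [a] at [t] is kept in context, where the closing [eassumption] of [solve_is_derive]
    finds it. *)
Let da0 : is_derive t 1 a (a^`() t).
Proof. exact: (is_derive_derive1n 0). Qed.

Let da1 : is_derive t 1 (a^`()) (a^`(2) t).
Proof. exact: (is_derive_derive1n 1). Qed.

Let da2 : is_derive t 1 (a^`(2)) (a^`(3) t).
Proof. exact: (is_derive_derive1n 2). Qed.

Let da3 : is_derive t 1 (a^`(3)) (a^`(4) t).
Proof. exact: (is_derive_derive1n 3). Qed.

Let dt := is_derive_id1 t.

(* Makes the derivatives syntactic atoms: [field] would otherwise compare them
   up to conversion. *)
Ltac generalize_jet :=
  generalize (a^`(4) t) (a^`(3) t) (a^`(2) t) (a^`() t) (a t);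
  intros a4 a3 a2 a1 a0.

(** The fourth derivative enters the curvature only here: [c6] carries a''' and has weight 27/20 in
    [alpha0], whence the factor -9/20. *)
Lemma is_derive_c6 : is_derive t 1 (c6 a)
  (- (1 / 3) * a^`(4) t - 12 * a^`() t ^+ 3 * a^`(2) t
   + 24 * a^`() t * a^`(2) t * t + 12 * a^`() t ^+ 2 - 24 * t).
Proof.
rewrite /c6; prove_is_derive; generalize_jet.
by field.
Qed.

Lemma is_derive_alpha3 :
  is_derive t 1 (alpha3 a) (- (1 / 10) * a^`(2) t).
Proof.
rewrite /alpha3; prove_is_derive; generalize_jet.
by field.
Qed.

Lemma is_derive_alpha2 :
  is_derive t 1 (alpha2 a) (3 / 5 * a^`() t * a^`(2) t - 1).
Proof.
rewrite /alpha2; prove_is_derive; generalize_jet.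
by field.
Qed.

Lemma is_derive_alpha1 : is_derive t 1 (alpha1 a)
  (- (27 / 10) * a^`() t ^+ 2 * a^`(2) t + 3 * a^`(2) t * t + 4 * a^`() t).
Proof.
rewrite /alpha1; prove_is_derive; generalize_jet.
by field.
Qed.

Lemma is_derive_alpha0 : is_derive t 1 (alpha0 a)
  (- (9 / 20) * a^`(4) t - 216 / 5 * a^`() t ^+ 3 * a^`(2) t
   + 36 * a^`() t * a^`(2) t * t + 21 * a^`() t ^+ 2
   + 3 * a t * a^`(2) t).
Proof.
have dc6 := is_derive_c6.
rewrite /alpha0; prove_is_derive; generalize_jet.
by field.
Qed.

Lemma derive1_matA (l : K) : (fun s => matA a l s)^`() t =
  (- (3 / 20) * a^`(3) t) *: sigma3
  + ((- (1 / 10) * a^`(2) t) * l ^+ 3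
     + (3 / 5 * a^`() t * a^`(2) t - 1) * l ^+ 2
     + (- (27 / 10) * a^`() t ^+ 2 * a^`(2) t + 3 * a^`(2) t * t
        + 4 * a^`() t) * l
     + (- (9 / 20) * a^`(4) t - 216 / 5 * a^`() t ^+ 3 * a^`(2) t
        + 36 * a^`() t * a^`(2) t * t + 21 * a^`() t ^+ 2
        + 3 * a t * a^`(2) t)) *: sigma_plus
  + (1 / 10 * a^`(2) t) *: sigma_minus.
Proof.
apply: derive1_val; rewrite /matA.
have d3 := is_derive_alpha3; have d2 := is_derive_alpha2.
have d1 := is_derive_alpha1; have d0 := is_derive_alpha0.
pose x s := - (3 / 20) * a^`(2) s.
pose p s := 1 / 30 * l ^+ 4 + alpha3 a s * l ^+ 3 + alpha2 a s * l ^+ 2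
  + alpha1 a s * l + alpha0 a s.
pose q s := 1 / 30 * l - alpha3 a s.
apply: (@is_deriveD _ _ _
  (fun s => x s *: sigma3 + p s *: sigma_plus) (fun s => q s *: sigma_minus)).
  apply: (@is_deriveD _ _ _
    (fun s => x s *: sigma3) (fun s => p s *: sigma_plus)).
    notypeclasses refine (is_deriveZl _ _ _ _ _ _); rewrite /x; prove_is_derive.
    generalize_jet.
    by field.
  notypeclasses refine (is_deriveZl _ _ _ _ _ _); rewrite /p; prove_is_derive.
  generalize_jet.
  by field.
notypeclasses refine (is_deriveZl _ _ _ _ _ _); rewrite /q; prove_is_derive.
generalize_jet.
by field.
Qed.

(** Write A = x sigma3 + p sigma_plus + q sigma_minus and C = r sigma_plus - (1/3) sigma_minus. Then
    [A, C] = -(p/3 + q r) sigma3 + 2 x r sigma_plus + (2x/3) sigma_minus. Along sigma3, the a''' of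
    [c6] inside p cancels the one in x_t; along sigma_minus, 2x/3 = -a''/10 cancels q_t. *)
Lemma zero_curvatureE (l : K) :
  (fun s => matA a l s)^`() t - (fun m => matC a m t)^`() l
    + commutator (matA a l t) (matC a l t)
  = (- (9 / 20) * (a^`(4) t + 120 * a^`() t ^+ 3 * a^`(2) t
      - 120 * a^`() t * a^`(2) t * t - 200 / 3 * a^`() t ^+ 2
      - 40 / 3 * a t * a^`(2) t + 200 / 9 * t)) *: sigma_plus.
Proof.
rewrite derive1_matA derive1_matC /commutator /matA /matC.
rewrite /alpha0 /c6 /alpha1 /alpha2 /alpha3 /beta0 /beta1 /beta2.
generalize_jet.
apply/matrixP => i j.
rewrite !mxE !big_ord_recl !big_ord0 /= !mxE.
(* Each of the four entries is a rational identity in [l], [t] and the jet. *)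
case: i => [[|[|//]] ?]; case: j => [[|[|//]] ?].
all: rewrite /= ?mulr1 ?mulr0 ?mul0r ?addr0 ?add0r ?subr0 ?sub0r.
all: by field.
Qed.

End LaxPairDerivatives.

(** * From vanishing curvature to the differential equation *)

Lemma sigma_plus_neq0 {K : numFieldType} : sigma_plus != 0 :> 'M[K]_2.
Proof.
by apply/eqP => /matrixP/(_ 0 1)/eqP; rewrite !mxE !eqxx oner_eq0.
Qed.

Lemma compatible_atP {K : numFieldType} (a : K -> K) (t : K) :
  (forall n : nat, (n < 4)%N -> derivable (derive1n n a) t 1) ->
  compatible_at (matA a) (matC a) t <-> isomonodromy_ode_at a t.
Proof.
move=> a_derivable; rewrite /compatible_at /isomonodromy_ode_at.
(* The curvature does not depend on the spectral parameter, so its value at 0 already yields the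
   equation. *)
split=> [/(_ 0)|ode l]; rewrite zero_curvatureE //; last first.
  by rewrite ode mulr0 scale0r.
(* The factor 9/20 can be cancelled because [K] has characteristic zero. *)
move/eqP; rewrite scaler_eq0 (negPf sigma_plus_neq0) orbF mulf_eq0 oppr_eq0.
by rewrite mulf_eq0 invr_eq0 !pnatr_eq0 => /eqP.
Qed.

Theorem theorem3p2 (K : numFieldType) (U : set K) (a : K -> K)
  (openU : open U)
  (a_smooth : forall (n : nat) (t : K),
     (n < 4)%N -> U t -> derivable (derive1n n a) t 1) :
  (forall t : K, U t -> compatible_at (matA a) (matC a) t) <->
  (forall t : K, U t -> isomonodromy_ode_at a t).
Proof.
(* Both conditions at [t] are governed by the jet of [a] at [t], so the equivalence is proved point
   by point. *)
have eqvU t : U t ->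
    compatible_at (matA a) (matC a) t <-> isomonodromy_ode_at a t.
  by move=> Ut; apply: compatible_atP => n n_lt4; exact: a_smooth.
by split=> H t Ut; apply/(eqvU t Ut); exact: H.
Qed.
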